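(* Let $N\ge 1$ and $f\ge 0$ be integers with $f<\frac{N}{3}$. In a partially synchronous message-passing system of $N$ processes $p_1,\dots,p_N$, at most $f$ of which are Byzantine (computationally bounded and possibly colluding), the RandSolomon protocol achieves Agreement: every correct process decides on the same random number, i.e. $\mathit{RAND}_i=\mathit{RAND}_j$ for all correct processes $p_i,p_j$.
   Context: **System model.** There are $N$ processes $p_1,\dots,p_N$; $[N]=\{1,\dots,N\}$. At most $f<N/3$ of them are Byzantine: they may deviate arbitrarily from the protocol (including by omitting messages) and may collaborate, but have limited computing power. The other processes are correct. Processes communicate over point-to-point channels; every message sent is eventually delivered, and the system is partially synchronous (there is an unknown time after which message delays are bounded by an unknown constant). A broadcast is best-effort: the sender sends the message to every process (itself included). **Primitives.** (i) Every process knows the public keys of all processes; each keeps its private key secret. $\{x\}_i$ denotes the *deterministic* public-key encryption of $x$ under $p_i$'s key (encrypting the same value twice under the same key gives the same ciphertext); it is decrypted correctly with $p_i$'s private key, and a computationally bounded process without that key has negligible probability of determining the encrypted value. (ii) $(x)_i$ denotes $x$ together with a digital signature of $p_i$. (iii) Consensus tolerating $f$ Byzantine processes, with: Termination (eventually every correct process outputs a value), Agreement (no two correct processes output different values), and External Validity (only a value $v$ with $\mathit{valid}(v)$ can be output, where $\mathit{valid}(v)$ holds iff $v$ contains $N-f$ inputs signed by $N-f$ different processes). (iv) A Reed-Solomon code with deterministic encoding: symbols of $z$ bits, data of $b(N-f)$ symbols, code-words of $bN$ symbols ($bN\le 2^z-1$), able to correct any $bf$ symbol erasures. A *block* is $b$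 consecutive symbols, and $b\cdot z\ge 256$; a code-word $s$ has blocks $s[1],\dots,s[N]$. (v) Correct processes can locally generate independent uniformly random numbers. **RandSolomon, code for $p_i$.** Local variables: $\mathit{RNL}=\emptyset$; $\mathit{SEEN}=\emptyset$ (a map from process indices to values); $\sigma_i[1..N][1..N]=\bot$. *Generation and commitment phase.* Generate a uniformly random $r_i$ of $b(N-f)$ symbols; encode $r_i$ into the code-word $s_i$; form $\underline{s_i}=(\{s_i[1]\}_1,\{s_i[2]\}_2,\dots,\{s_i[N]\}_N)_i$; broadcast $\langle\mathit{GENERATED},\underline{s_i}\rangle$. Upon receiving $\langle \mathit{GENERATED},\underline{s_j}\rangle$ (signed by $p_j$): set $\mathit{SEEN}[j]:=\underline{s_j}$; if $|\mathit{SEEN}|=N-f$, set $\mathit{RNL}:=\mathrm{Consensus}(\mathit{SEEN})$. *Reveal phase* (upon $\mathit{RNL}\ne\emptyset$). For each $\underline{s_j}\in \mathit{RNL}$, decrypt the $i$-th component of $\underline{s_j}$ into $s_j[i]$ and set $\sigma_i[j][i]:=s_j[i]$; then broadcast $\langle\mathit{REVEAL},(\sigma_i[\cdot][i])_i\rangle$. Upon receiving $\langle\mathit{REVEAL},(\sigma_j)_j\rangle$ with $j\ne i$ (processed after $\mathit{RNL}\neq\emptyset$): for each $\underline{s_k}\in\mathit{RNL}$, if $\{\sigma_j[k][j]\}_j$ equals the $j$-th component $\underline{s_k}[j]$ of $\underline{s_k}$, set $\sigma_i[k][j]:=\sigma_j[k][j]$. *Result computation phase* (upon $\mathit{RNL}\neq\emptyset$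 and, for every $\underline{s_j}\in\mathit{RNL}$, there being $K\subseteq[N]$ with $|K|=N-f$ and $\sigma_i[j][k]\ne\bot$ for all $k\in K$). Set $\mathit{step}:=0$ and $\mathit{PRE}:=0$ ($N-f$ blocks). For each $\underline{s_j}\in\mathit{RNL}$ in increasing order of $j$: decode $\sigma_i[j]$ (entries $\bot$ treated as erasures) into $\tilde r_j$; if encoding $\tilde r_j$ and encrypting its $N$ blocks under the respective public keys does not reproduce $\underline{s_j}$, set $\tilde r_j:=0$; set $\mathit{PRE}:=\mathit{PRE}\oplus(\tilde r_j\gg\mathit{step})$, where $\gg \mathit{step}$ is the circular right shift by $\mathit{step}$ blocks; increment $\mathit{step}$. Finally, with $M=N-f$, set $\mathit{RAND}_i[k]:=\mathit{PRE}[2k-1]\oplus\mathit{PRE}[2k]$ for $1\le k\le\lfloor M/2\rfloor$, and, if $M$ is odd, additionally XOR $\mathit{PRE}[M]$ into the last block $\mathit{RAND}_i[\lfloor M/2\rfloor]$. Decide $\mathit{RAND}_i$. A phase begins when the first correct process enters it. *)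

(* Defs.v *)
From HB Require Import structures.
From mathcomp Require Import all_boot all_order all_algebra.

Set Implicit Arguments.
Unset Strict Implicit.
Unset Printing Implicit Defensive.

Import GRing.Theory.

(* Processes, blocks and symbols are numbered from 0: p_(i+1) is i : 'I_N.
   A symbol is a z-bit string 'rV['F_2]_z, so that [+%R] is the bitwise XOR;
   row l of a block is its l-th symbol. *)
Notation block b z := 'M['F_2]_(b, z).
Notation data N f b z := {ffun 'I_(N - f) -> block b z}
  (only parsing).
Notation codeword N b z := {ffun 'I_N -> block b z} (only parsing).

(* The l-th symbol of the k-th block is at position (k, l).  [None] marks an
   erased symbol; on words that do not come from a code-word by erasing at most
   b * f symbols, [rs_decode] is unconstrained. *)
Record reed_solomon (N f b z : nat) := ReedSolomon {
  rs_field : finFieldType;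
  rs_repr : {additive 'rV['F_2]_z -> rs_field};
  rs_repr_bij : bijective rs_repr;
  rs_point : 'I_N * 'I_b -> rs_field;
  rs_point_inj : injective rs_point;
  rs_point_neq0 : forall kl, rs_point kl != 0%R;
  rs_encode : data N f b z -> codeword N b z;
  rs_encode_code : forall r, exists2 p : {poly rs_field},
    size p <= b * (N - f) &
    forall k l, rs_repr (row l (rs_encode r k)) = p.[rs_point (k, l)]%R;
  rs_decode : {ffun 'I_N * 'I_b -> option 'rV['F_2]_z} -> data N f b z;
  rs_decode_erasures : forall r (E : {set 'I_N * 'I_b}), #|E| <= b * f ->
    rs_decode [ffun kl => if kl \in E then None
                          else Some (row kl.2 (rs_encode r kl.1))] = r
}.

Inductive payload (N b z : nat) (cipher : Type) :=
  | PCommit of {ffun 'I_N -> cipher}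
  | PReveal of {ffun 'I_N -> option (block b z)}.
Arguments PCommit {N b z cipher}.
Arguments PReveal {N b z cipher}.

(* [encrypt] is a function of the key and the plaintext only: encryption is
   deterministic.  [decrypt] may fail, or return any block, on a string that is
   not a ciphertext.  Secrecy and unforgeability are not fields: Byzantine
   processes may send arbitrary messages in the executions below, which
   therefore include all those with a computationally bounded adversary. *)
Record crypto (N b z : nat) := Crypto {
  pkey : Type;
  skey : Type;
  cipher : eqType;
  signature : Type;
  encrypt : pkey -> block b z -> cipher;
  decrypt : skey -> cipher -> option (block b z);
  sign : skey -> payload N b z cipher -> signature;
  verify : pkey -> payload N b z cipher -> signature -> bool;
  pub : 'I_N -> pkey;
  priv : 'I_N -> skey;
  encryptK : forall i x, decrypt (priv i) (encrypt (pub i) x) = Some x;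
  signK : forall i m, verify (pub i) m (sign (priv i) m)
}.

Section Protocol.
Context {N f b z : nat}.
Context (rs : reed_solomon N f b z) (cr : crypto N b z).

Notation commit := {ffun 'I_N -> cipher cr}.
Notation column := {ffun 'I_N -> option (block b z)}.

Record signed (T : Type) := Signed {
  signer : 'I_N;
  body : T;
  sig : signature cr
}.

Definition sign_as T (wrap : T -> payload N b z (cipher cr)) (i : 'I_N) (x : T) :
    signed T :=
  Signed i x (sign (priv cr i) (wrap x)).

Definition verified T (wrap : T -> payload N b z (cipher cr)) (s : signed T) : bool :=
  verify (pub cr (signer s)) (wrap (body s)) (sig s).

Inductive message :=
  | GENERATED of signed commit
  | REVEAL of signed column.

(* Partial maps from process indices to signed commitments: the type of SEEN
   and RNL. *)
Notation seen_map := {ffun 'I_N -> option (signed commit)}.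

Definition mdom (v : seen_map) : {set 'I_N} := [set j | isSome (v j)].

Definition valid (v : seen_map) : Prop :=
  exists2 K : {set 'I_N}, #|K| = N - f &
    forall j, j \in K ->
      exists s, [/\ v j = Some s, signer s = j & verified PCommit s].

Notation rand := {ffun 'I_(N - f)./2 -> block b z}.

(* In the state of process i, [sigma k j] is sigma_i[k][j] and [None] is bottom;
   [proposed] is the argument of the call to Consensus. *)
Record lstate := LState {
  generated : option (data N f b z);
  SEEN : seen_map;
  proposed : option seen_map;
  RNL : seen_map;
  revealed : bool;
  sigma : {ffun 'I_N -> {ffun 'I_N -> option (block b z)}};
  RAND : option rand
}.

Definition init : lstate :=
  LState None [ffun _ => None] None [ffun _ => None] false
    [ffun _ => [ffun _ => None]] None.

Definition commitment (r : data N f b z) : commit :=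
  [ffun k => encrypt (pub cr k) (rs_encode rs r k)].

Definition do_generate (r : data N f b z) (s : lstate) : lstate :=
  LState (Some r) (SEEN s) (proposed s) (RNL s) (revealed s) (sigma s) (RAND s).

(* Consensus is called only once. *)
Definition recv_generated (m : signed commit) (s : lstate) : lstate :=
  if verified PCommit m then
    let seen := [ffun j => if j == signer m then Some m else SEEN s j] in
    let prop := if ~~ isSome (proposed s) && (#|mdom seen| == N - f)
                then Some seen else proposed s in
    LState (generated s) seen prop (RNL s) (revealed s) (sigma s) (RAND s)
  else s.


Definition do_return (v : seen_map) (s : lstate) : lstate :=
  LState (generated s) (SEEN s) (proposed s) v (revealed s) (sigma s) (RAND s).

Definition reveal_sigma (i : 'I_N) (s : lstate) :
    {ffun 'I_N -> {ffun 'I_N -> option (block b z)}} :=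
  [ffun j => [ffun k =>
    if k == i then
      if RNL s j is Some c then decrypt (priv cr i) (body c i) else sigma s j k
    else sigma s j k]].

Definition do_reveal (i : 'I_N) (s : lstate) : lstate :=
  LState (generated s) (SEEN s) (proposed s) (RNL s) true (reveal_sigma i s)
    (RAND s).

Definition reveal_column (i : 'I_N) (s : lstate) : column :=
  [ffun j => reveal_sigma i s j i].

Definition recv_reveal (i : 'I_N) (m : signed column) (s : lstate) : lstate :=
  if verified PReveal m && (signer m != i) then
    let j := signer m in
    let sigma' := [ffun k => [ffun l =>
      if l == j then
        match RNL s k, body m k with
        | Some c, Some x =>
            if encrypt (pub cr j) x == body c j then Some x else sigma s k l
        | _, _ => sigma s k l
        end
      else sigma s k l]] in
    LState (generated s) (SEEN s) (proposed s) (RNL s) (revealed s) sigma'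
      (RAND s)
  else s.

Definition recv (i : 'I_N) (m : message) (s : lstate) : lstate :=
  match m with
  | GENERATED c => recv_generated c s
  | REVEAL c => recv_reveal i c s
  end.

Definition can_decide (s : lstate) : Prop :=
  mdom (RNL s) != set0 /\
  forall j, j \in mdom (RNL s) ->
    exists2 K : {set 'I_N}, #|K| = N - f &
      forall k, k \in K -> sigma s j k != None.

(* Out of bounds, [blk] is the zero block. *)
Definition blk M (P : {ffun 'I_M -> block b z}) (k : nat) : block b z :=
  if insub k is Some i then P i else 0%R.

(* Block k of the result is block k - s modulo M of r. *)
Definition cshiftr M (r : {ffun 'I_M -> block b z}) (s : nat) :
    {ffun 'I_M -> block b z} :=
  [ffun k : 'I_M => blk r ((k + (M - s %% M)) %% M)].

Definition decoded (sg : {ffun 'I_N -> option (block b z)}) : data N f b z :=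
  rs_decode rs [ffun kl => omap (row kl.2) (sg kl.1)].

Definition rtilde (s : lstate) (j : 'I_N) : data N f b z :=
  let r := decoded (sigma s j) in
  if RNL s j is Some c then if commitment r == body c then r else 0%R else 0%R.

(* The first component of the pair is [step]. *)
Definition PRE (s : lstate) : data N f b z :=
  (foldl (fun (acc : nat * data N f b z) j =>
            (acc.1.+1, (acc.2 + cshiftr (rtilde s j) acc.1)%R))
     (0, 0%R) [seq j <- enum 'I_N | j \in mdom (RNL s)]).2.

(* Shifting indices to start from 0, PRE[2k-1] (+) PRE[2k] becomes
   PRE[2k] (+) PRE[2k+1].  For N - f = 1 there is no block at all. *)
Definition result (s : lstate) : rand :=
  let M := N - f in
  [ffun k : 'I_M./2 =>
     (blk (PRE s) k.*2 + blk (PRE s) k.*2.+1 +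
      (if odd M && (k.+1 == M./2) then blk (PRE s) M.-1 else 0))%R].

Definition do_decide (s : lstate) : lstate :=
  LState (generated s) (SEEN s) (proposed s) (RNL s) (revealed s) (sigma s)
    (Some (result s)).

(* Steps of a correct process.  [Handle n] runs the handler of the copy,
   already delivered, of the message sent at step n of the execution;
   [Return v] is the return of Consensus with output v.  [Generate r] can occur
   with every r, that is with every outcome of the uniform random draw. *)
Inductive laction :=
  | Generate of data N f b z
  | Handle of nat
  | Return of seen_map
  | Reveal
  | Decide.

(* [Deliver i n]: the copy addressed to i of the message sent at step n reaches
   i.  [ByzSend j i m]: the Byzantine process j sends m, an arbitrary message,
   to i alone. *)
Inductive action :=
  | Tick
  | Local of 'I_N & laction
  | Deliver of 'I_N & nat
  | ByzSend of 'I_N & 'I_N & message.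

(* [act t] is the t-th step of the system, [clock t] the global time at which it
   is taken, and [st t i] the state of i just before it.  The states of the
   Byzantine processes are meaningless. *)
Record run := Run {
  act : nat -> action;
  st : nat -> 'I_N -> lstate;
  clock : nat -> nat
}.

Definition message_to (rho : run) (n : nat) (i : 'I_N) : option message :=
  match act rho n with
  | Local j (Generate r) =>
      Some (GENERATED (sign_as PCommit j (commitment r)))
  | Local j Reveal =>
      Some (REVEAL (sign_as PReveal j (reveal_column j (st rho n j))))
  | ByzSend _ i' m => if i' == i then Some m else None
  | _ => None
  end.

Definition local_effect (rho : run) (i : 'I_N) (a : laction) (s : lstate) :
    lstate :=
  match a with
  | Generate r => do_generate r s
  | Handle n => if message_to rho n i is Some m then recv i m s else s
  | Return v => do_return v s
  | Reveal => do_reveal i s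
  | Decide => do_decide s
  end.

Definition local_guard (rho : run) (t : nat) (i : 'I_N) (a : laction) : Prop :=
  let s := st rho t i in
  match a with
  | Generate _ => ~~ isSome (generated s)
  | Handle n =>
      [/\ exists2 u, u < t & act rho u = Deliver i n,
          forall u, u < t -> act rho u <> Local i (Handle n)
        & match message_to rho n i with
          | Some (GENERATED _) => True
          | Some (REVEAL _) => mdom (RNL s) != set0
          | None => False
          end]
  | Return _ =>
      isSome (proposed s) /\
      forall u v, u < t -> act rho u <> Local i (Return v)
  | Reveal => mdom (RNL s) != set0 /\ ~~ revealed s
  | Decide => can_decide s /\ ~~ isSome (RAND s)
  end.

Definition is_Return (a : laction) : bool := if a is Return _ then true else false.

Definition deliverable (rho : run) (t : nat) (i : 'I_N) (n : nat) : Prop :=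
  [/\ n < t, isSome (message_to rho n i)
    & forall u, u < t -> act rho u <> Deliver i n].

(* The correct processes follow the protocol: safety, then weak fairness.  The
   return of Consensus is governed by [consensus_spec]. *)
Record follows_protocol (C : {set 'I_N}) (rho : run) : Prop := {
  fp_init : forall i, i \in C -> st rho 0 i = init;
  fp_step : forall t i, i \in C ->
    st rho t.+1 i =
      match act rho t with
      | Local j a => if j == i then local_effect rho i a (st rho t i)
                     else st rho t i
      | _ => st rho t i
      end;
  fp_guard : forall t,
    match act rho t with
    | Tick => True
    | Local i a => i \in C /\ local_guard rho t i a
    | Deliver i n => deliverable rho t i n
    | ByzSend j _ _ => j \notin C
    end;
  fp_fair : forall t i a, i \in C -> ~~ is_Return a -> local_guard rho t i a ->
    exists2 u, t <= u & act rho u = Local i a \/ ~ local_guard rho u i a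
}.

(* The delays are bounded by [delta] for the messages sent from time [gst] on;
   the earlier ones are only delivered eventually. *)
Definition partially_synchronous (rho : run) : Prop :=
  [/\ forall t u, t <= u -> clock rho t <= clock rho u,
      forall T, exists t, T <= clock rho t,
      forall n i, isSome (message_to rho n i) ->
        exists t, act rho t = Deliver i n
    & exists gst delta, forall n i, isSome (message_to rho n i) ->
        gst <= clock rho n ->
        exists2 t, act rho t = Deliver i n & clock rho t <= clock rho n + delta].

Record consensus_spec (C : {set 'I_N}) (rho : run) : Prop := {
  cs_termination :
    (forall i, i \in C -> exists t, isSome (proposed (st rho t i))) ->
    forall i, i \in C -> exists t v, act rho t = Local i (Return v);
  cs_agreement : forall i j t u v w, i \in C -> j \in C ->
    act rho t = Local i (Return v) -> act rho u = Local j (Return w) -> v = w;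
  cs_validity : forall i t v, i \in C ->
    act rho t = Local i (Return v) -> valid v
}.

Definition execution (C : {set 'I_N}) (rho : run) : Prop :=
  [/\ follows_protocol C rho, partially_synchronous rho & consensus_spec C rho].

Definition decides (rho : run) (i : 'I_N) (x : rand) : Prop :=
  exists t, RAND (st rho t i) = Some x.

End Protocol.

Arguments run {N} f {b z} cr.

(* Main.v *)
Require Import Defs.
From mathcomp Require Import all_boot all_order all_algebra.

(* Agreement of Consensus gives all correct processes the same RNL.  A block
   that a correct process stores for a commitment always equals the decryption
   of the corresponding component: this holds by construction for its own block
   and by the re-encryption test for the others.  So if the commitment is that
   of some r, every stored block is the one of the code-word of r, and any N - f
   of them decode to r.  Hence either no process finds a preimage of the
   commitment, and all use 0, or all decode the same one. *)

Set Implicit Arguments.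
Unset Strict Implicit.
Unset Printing Implicit Defensive.

Section Agreement.
Context {N f b z : nat} (rs : reed_solomon N f b z) (cr : crypto N b z).

Notation commit := {ffun 'I_N -> cipher cr}.
Notation state := (@lstate N f b z cr).
Notation sigma_row := {ffun 'I_N -> option (block b z)}.

(** Stated through decryption rather than re-encryption: a process decrypts its own block without
    any further test, and a Byzantine component may decrypt to a block that does not encrypt back to
    it. *)
Definition opens (com : commit) (sg : sigma_row) : Prop :=
  forall l x, sg l = Some x -> decrypt (priv cr l) (com l) = Some x.

Definition complete (sg : sigma_row) : Prop :=
  exists2 K : {set 'I_N}, #|K| = N - f & forall k, k \in K -> sg k != None.

(** By [encryptK], every stored block is that of the code-word of [r]; at most [f] blocks are
    missing, that is at most [b * f] symbols, which the code corrects. *)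
Lemma decoded_opening r sg :
  f <= N -> opens (commitment rs cr r) sg -> complete sg ->
  decoded rs sg = r.
Proof.
move=> le_fN op [K cardK sgK].
pose E := setX [set k | sg k == None] [set: 'I_b].
have cardE : #|E| <= b * f.
  rewrite cardsX cardsT card_ord mulnC leq_mul2l; apply/orP; right.
  have sub : [set k | sg k == None] \subset ~: K.
    apply/subsetP => k; rewrite !inE => sgk0.
    by apply/negP => /sgK; rewrite sgk0.
  apply: leq_trans (subset_leq_card sub) _.
  have := cardsC K; rewrite cardK card_ord => eqN.
  by rewrite -(leq_add2l (N - f)) eqN subnK.
rewrite -[RHS](rs_decode_erasures rs r cardE) /decoded; congr rs_decode.
apply/ffunP => -[k l]; rewrite !ffunE !inE andbT /=.
case sgk: (sg k) => [x|] //=.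
by have := op _ _ sgk; rewrite ffunE encryptK => -[->].
Qed.

Lemma decoded_agree (com : commit) sg1 sg2 :
  f <= N -> opens com sg1 -> opens com sg2 -> complete sg1 -> complete sg2 ->
  (if commitment rs cr (decoded rs sg1) == com then decoded rs sg1 else 0%R) =
  (if commitment rs cr (decoded rs sg2) == com then decoded rs sg2 else 0%R).
Proof.
move=> le_fN op1 op2 c1 c2; case: eqP => [e1|n1].
  have -> : decoded rs sg2 = decoded rs sg1.
    by apply: decoded_opening => //; rewrite e1.
  by rewrite e1 eqxx.
case: eqP => // e2; case: n1.
by have -> : decoded rs sg1 = decoded rs sg2
  by apply: decoded_opening => //; rewrite e2.
Qed.

(** Requiring an entry of [RNL] behind each stored block forces [sigma] to be empty while [RNL] is,
    so that the invariant survives the return of Consensus. *)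
Definition sound (s : state) : Prop :=
  forall k l x, sigma s k l = Some x ->
    exists2 c, RNL s k = Some c & decrypt (priv cr l) (body c l) = Some x.

Lemma sound_recv i m s : sound s -> sound (recv i m s).
Proof.
move=> snd; case: m => [c|c] /=; first by rewrite /recv_generated; case: ifP.
rewrite /recv_reveal; case: ifP => // _ k l x /=; rewrite !ffunE.
case: eqP => [->|_]; last exact: snd.
case rk: (RNL s k) => [d|]; last by move/snd; rewrite rk.
case: (body c k) => [y|]; last by move/snd; rewrite rk.
case: eqP => [e [<-]|_]; last by move/snd; rewrite rk.
by exists d => //; rewrite -e encryptK.
Qed.

Lemma sound_reveal i s : sound s -> sound (do_reveal i s).
Proof.
move=> snd k l x /=; rewrite !ffunE.
case: eqP => [->|_]; last exact: snd.
case rk: (RNL s k) => [d|]; last by move/snd; rewrite rk.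
by exists d.
Qed.

Lemma RNL_recv i m (s : state) : RNL (recv i m s) = RNL s.
Proof.
by case: m => c /=; rewrite /recv_generated /recv_reveal; case: ifP.
Qed.

Lemma RAND_recv i m (s : state) : RAND (recv i m s) = RAND s.
Proof.
by case: m => c /=; rewrite /recv_generated /recv_reveal; case: ifP.
Qed.

Lemma result_agree (s1 s2 : state) :
  f <= N -> RNL s1 = RNL s2 -> sound s1 -> sound s2 ->
  can_decide s1 -> can_decide s2 -> result rs s1 = result rs s2.
Proof.
move=> le_fN eR snd1 snd2 [_ c1] [_ c2].
have op (s : state) k c : sound s -> RNL s k = Some c ->
    opens (body c) (sigma s k).
  by move=> snd rk l x /snd[d]; rewrite rk => -[<-].
suff eP : PRE rs s1 = PRE rs s2 by rewrite /result eP.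
have er k : rtilde rs s1 k = rtilde rs s2 k.
  rewrite /rtilde; case r2: (RNL s2 k) => [c|]; rewrite eR r2 //.
  have r1 : RNL s1 k = Some c by rewrite eR.
  apply: decoded_agree => //; try exact: op.
    by apply: c1; rewrite inE r1.
  by apply: c2; rewrite inE r2.
rewrite /PRE eR; congr (_.2).
(* The accumulator is generalized, as both the shift and the partial sum change along the fold. *)
elim: [seq _ <- _ | _] (0, 0%R) => //= k ks IH acc.
by rewrite er IH.
Qed.

Section Execution.
Context (C : {set 'I_N}) (rho : run f cr) (fp : follows_protocol rs C rho).
Context (i : 'I_N) (iC : i \in C).

Definition RNL_origin (t : nat) (s : state) : Prop :=
  RNL s = [ffun _ => None] \/
  exists2 u, u < t & act rho u = Local i (Return (RNL s)).

(** Only local steps of [i] change its state, and each comes with its guard. [P] depends on the time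
    because [RNL_origin] refers to past steps. *)
Lemma st_ind (P : nat -> state -> Prop) :
  P 0 (init cr) ->
  (forall t s, P t s -> P t.+1 s) ->
  (forall t a, P t (st rho t i) -> act rho t = Local i a ->
     local_guard rs rho t i a -> P t.+1 (local_effect rs rho i a (st rho t i))) ->
  forall t, P t (st rho t i).
Proof.
move=> P0 Pstutter Plocal; elim=> [|t IH]; first by rewrite (fp_init fp).
rewrite (fp_step fp) //; have := fp_guard fp t.
case ea: (act rho t) => [|k a|k n|k k' m]; try by move=> _; apply: Pstutter.
case: eqP => [ek|_] [_ g]; last exact: Pstutter.
by subst k; apply: Plocal.
Qed.

Lemma RNL_origin_st t : RNL_origin t (st rho t i).
Proof.
apply: st_ind => [|u s [?|[w lt ew]]|u a IH ea _] {t}.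
- by left.
- by left.
- by right; exists w; rewrite // ltnW.
(* This settles every action except [Return], the only one that writes [RNL]. *)
have keep s : RNL s = RNL (st rho u i) -> RNL_origin u.+1 s.
  rewrite /RNL_origin => ->; case: IH => [|[w lt ew]]; first by left.
  by right; exists w; rewrite // ltnW.
case: a ea => [r|n|v||] ea /=; try exact: keep.
  by apply: keep; case: message_to => // m; rewrite RNL_recv.
by right; exists u.
Qed.

Lemma sound_st t : sound (st rho t i).
Proof.
apply: (st_ind (P := fun _ => sound)) => //.
  by move=> k l x; rewrite !ffunE.
move=> u [r|n|v||] snd ea g //=.
- by case: message_to => // m; apply: sound_recv.
- (* Consensus returns once, so RNL, hence sigma, is still empty. *)
  move=> k l x /snd[c].
  case: (RNL_origin_st u) => [->|[w lt ew]]; first by rewrite ffunE.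
  by case: g => _ /(_ w _ lt ew).
- exact: sound_reveal.
Qed.

(** Only [Decide] writes [RAND]; the witness is the time of that step, whose guard gives
    [can_decide]. *)
Lemma decides_result x :
  decides rho i x ->
  exists t, can_decide (st rho t i) /\ x = result rs (st rho t i).
Proof.
case=> t; move: t.
apply: (st_ind (P := fun _ s => RAND s = Some x -> exists t,
  can_decide (st rho t i) /\ x = result rs (st rho t i))) => //.
move=> u [r|n|v||] IH ea g //=.
- by case: message_to => // m; rewrite RAND_recv.
- by case: g => cd _ [<-]; exists u.
Qed.

(** Deciding needs a non-empty [RNL], which rules out the initial value. *)
Lemma can_decide_returned t :
  can_decide (st rho t i) ->
  exists u, act rho u = Local i (Return (RNL (st rho t i))).
Proof.
case=> n0 _; case: (RNL_origin_st t) => [e|[u _ eu]]; last by exists u.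
case/set0Pn: n0 => k; by rewrite e inE ffunE.
Qed.

End Execution.
End Agreement.

Theorem proposition1 (N f b z : nat)
    (N_ge1 : 1 <= N) (f_lt : 3 * f < N)
    (bN_le : b * N <= 2 ^ z - 1) (bz_ge : 256 <= b * z)
    (rs : reed_solomon N f b z) (cr : crypto N b z)
    (C : {set 'I_N}) (byz_le : #|~: C| <= f)
    (rho : run f cr) (rho_exec : execution rs C rho)
    (i j : 'I_N) (i_correct : i \in C) (j_correct : j \in C)
    (RAND_i RAND_j : {ffun 'I_(N - f)./2 -> block b z}) :
  decides rho i RAND_i -> decides rho j RAND_j -> RAND_i = RAND_j.
Proof.
case: rho_exec => fp _ cs.
case/(decides_result fp i_correct) => t [cdi ->].
case/(decides_result fp j_correct) => u [cdj ->].
have [t' ei] := can_decide_returned fp i_correct cdi.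
have [u' ej] := can_decide_returned fp j_correct cdj.
apply: result_agree => //; try exact: (sound_st fp).
- by apply: leq_trans (ltnW f_lt); rewrite leq_pmull.
- exact: cs_agreement cs _ _ _ _ _ _ i_correct j_correct ei ej.
Qed.
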